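(* Let $d,k\ge 1$ be integers, let $\rho_S$ be a density operator on $\mathcal H_S=\mathbb C^d$ and let $\{M_S^a\}_{a=1}^k$ be a POVM on $\mathcal H_S$. Let $\{\Gamma_e\}_{e=1}^k$ be a feasible solution of the semidefinite program (SDP) associated with $(\rho_S,\{M_S^a\}_a)$ (defined in the context) achieving some objective value $c$. Then there exist a finite-dimensional Hilbert space $\mathcal H_M$, operators $K_M^{i,j|a}$ on $\mathcal H_M$ ($1\le i,j\le d$, $1\le a\le k$) and (possibly subnormalized) states $\tilde\sigma^e_{SM}$ on $\mathcal H_S\otimes\mathcal H_M$ ($1\le e\le k$) such that, with $$\Pi^a_{SM}:=\sum_{i,j=1}^d |i\rangle\langle j|_S\otimes K_M^{i,j|a},\qquad a=1,\dots,k,$$ the pair $\big(\{\tilde\sigma^e_{SM}\}_e,\{\Pi^a_{SM}\}_a\big)$ is a feasible solution of the problem (P) associated with $(\rho_S,\{M_S^a\}_a)$ (defined in the context) achieving the same objective value $c$.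
   Context: Fix an orthonormal basis $\{|i\rangle\}_{i=1}^d$ of $\mathcal H_S=\mathbb C^d$. The indices $a,b,e$ range over $\{1,\dots,k\}$ and $i,j,l,m,n$ over $\{1,\dots,d\}$. A subnormalized state is a positive semidefinite operator of trace at most $1$. **Problem (P).** The variables are an auxiliary Hilbert space $\mathcal H_M$ (of unrestricted dimension), a projective measurement $\{\Pi^a_{SM}\}_{a=1}^k$ on $\mathcal H_S\otimes\mathcal H_M$ (i.e. $(\Pi^a_{SM})^\dagger=\Pi^a_{SM}$, $\Pi^a_{SM}\Pi^b_{SM}=\delta_{ab}\Pi^a_{SM}$, $\sum_a\Pi^a_{SM}=\mathbb 1$), and subnormalized states $\{\tilde\sigma^e_{SM}\}_{e=1}^k$ on $\mathcal H_S\otimes\mathcal H_M$. Maximize the objective $\sum_a \mathrm{Tr}[\Pi^a_{SM}\tilde\sigma^a_{SM}]$ subject to: - $\mathrm{Tr}_M\big[\sum_e\tilde\sigma^e_{SM}\big]=\rho_S$; - $\mathrm{Tr}_M\big[\Pi^a_{SM}\big(\mathbb 1_S\otimes \mathrm{Tr}_S[\sum_e\tilde\sigma^e_{SM}]\big)\big]=M_S^a$ for all $a$; - $\mathrm{Tr}\big[\Pi^a_{SM}\sum_e\tilde\sigma^e_{SM}\big]=\mathrm{Tr}[M_S^a\rho_S]$ for all $a$. **The SDP.** Let $\mathcal O:=\{\mathbb 1\}\cup\{K_M^{i,j|a}:1\le a\le k,\ 1\le i,j\le d\}$ be a set of $1+kd^2$ distinct formal symbols, with the conventions $\mathbb 1^\dagger=\mathbb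 1$ and $(K_M^{i,j|a})^\dagger=K_M^{j,i|a}$. Let $\{|s\rangle\}_{s\in\mathcal O}$ be an orthonormal basis of $\mathbb C^{|\mathcal O|}$. The variables are complex matrices $\Gamma_1,\dots,\Gamma_k$ acting on $\mathbb C^d\otimes\mathbb C^{|\mathcal O|}$; write $\langle m|\langle s|\Gamma_e|n\rangle|t\rangle$ for their entries. Maximize the objective $$\sum_{a,i,j}\langle j|\langle\mathbb 1|\,\Gamma_a\,|i\rangle|K_M^{i,j|a}\rangle$$ subject to: - $\Gamma_e\succeq 0$ for all $e$; - $\sum_e\langle i|\langle\mathbb 1|\Gamma_e|j\rangle|\mathbb 1\rangle=\langle i|\rho_S|j\rangle$ for all $i,j$; - $\sum_{e,l}\langle l|\langle\mathbb 1|\Gamma_e|l\rangle|K_M^{i,j|a}\rangle=\langle i|M_S^a|j\rangle$ for all $a,i,j$; - $\sum_{e,i,j}\langle j|\langle\mathbb 1|\Gamma_e|i\rangle|K_M^{i,j|a}\rangle=\mathrm{Tr}[M_S^a\rho_S]$ for all $a$; - $\langle m|\langle\mathbb 1|\Gamma_e|n\rangle|s\rangle=\langle m|\langle s^\dagger|\Gamma_e|n\rangle|\mathbb 1\rangle$ for all $s\in\mathcal O$ and all $e,m,n$; - $\sum_a\langle m|\langle\mathbb 1|\Gamma_e|n\rangle|K_M^{i,j|a}\rangle=\delta_{ij}\langle m|\langle\mathbb 1|\Gamma_e|n\rangle|\mathbb 1\rangle$ for all $e,m,n,i,j$; - $\sum_l\langle m|\langle (K_M^{l,j|b})^\dagger|\,\Gamma_e\,|n\rangle|(K_M^{l,i|a})^\dagger\rangle=\delta_{ab}\langle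 m|\langle\mathbb 1|\Gamma_e|n\rangle|K_M^{i,j|a}\rangle$ for all $a,b,e,m,n,i,j$. (The entry $\langle m|\langle s|\Gamma_e|n\rangle|t\rangle$ plays the role of $\mathrm{Tr}[(|n\rangle\langle m|\otimes ts^\dagger)\tilde\sigma^e_{SM}]$.) *)

(* Defs.v *)
From HB Require Import structures.
From mathcomp Require Import all_boot all_order all_algebra.
From mathcomp Require Import spectral sesquilinear.
From mathcomp Require Import complex mxtens reals.

Set Implicit Arguments.
Unset Strict Implicit.
Unset Printing Implicit Defensive.

Import Order.TTheory GRing.Theory Num.Theory.
Local Open Scope ring_scope.
Local Open Scope sesquilinear_scope.

(* Over a numClosedFieldType, 0 <= z means that z is real and nonnegative. *)
Definition psdmx (C : numClosedFieldType) (n : nat) (A : 'M[C]_n) : Prop :=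
  A^t* = A /\ forall v : 'cV[C]_n, 0 <= (v^t* *m A *m v) 0 0.

Definition density_operator (C : numClosedFieldType) (n : nat)
    (rho : 'M[C]_n) : Prop :=
  psdmx rho /\ \tr rho = 1.

Definition subnormalized_state (C : numClosedFieldType) (n : nat)
    (sigma : 'M[C]_n) : Prop :=
  psdmx sigma /\ \tr sigma <= 1.

Definition povm (C : numClosedFieldType) (k n : nat)
    (M : 'I_k -> 'M[C]_n) : Prop :=
  (forall a, psdmx (M a)) /\ \sum_a M a = 1%:M.

Definition projective_measurement (C : numClosedFieldType) (k n : nat)
    (Pi : 'I_k -> 'M[C]_n) : Prop :=
  [/\ forall a, (Pi a)^t* = Pi a,
      forall a b, Pi a *m Pi b = if a == b then Pi a else 0
    & \sum_a Pi a = 1%:M].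

(* Operators on C^d (x) C^D are matrices of size d * D; the product basis
   vector |i>|p> has index mxtens_index (i, p), the convention of A *t B. *)
Definition ptraceM (C : numClosedFieldType) (d D : nat)
    (X : 'M[C]_(d * D)) : 'M[C]_d :=
  \matrix_(i, j) \sum_(p < D) X (mxtens_index (i, p)) (mxtens_index (j, p)).

Definition ptraceS (C : numClosedFieldType) (d D : nat)
    (X : 'M[C]_(d * D)) : 'M[C]_D :=
  \matrix_(p, q) \sum_(i < d) X (mxtens_index (i, p)) (mxtens_index (i, q)).

(* P is the optimization of \sum_a Tr[Pi^a sigma^a] over auxiliary spaces of
   arbitrary dimension; P_feasible describes its feasible points whose
   auxiliary space is C^D. *)
Record P_feasible (C : numClosedFieldType) (d k D : nat)
    (rho : 'M[C]_d) (M : 'I_k -> 'M[C]_d)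
    (sigma Pi : 'I_k -> 'M[C]_(d * D)) : Prop := {
  P_meas : projective_measurement Pi;
  P_state : forall e, subnormalized_state (sigma e);
  P_marginal : ptraceM (\sum_e sigma e) = rho;
  P_povm : forall a,
    ptraceM (Pi a *m ((1%:M : 'M[C]_d) *t ptraceS (\sum_e sigma e))) = M a;
  P_prob : forall a, \tr (Pi a *m \sum_e sigma e) = \tr (M a *m rho) }.

Definition P_objective (C : numClosedFieldType) (d k D : nat)
    (sigma Pi : 'I_k -> 'M[C]_(d * D)) : C :=
  \sum_a \tr (Pi a *m sigma a).

(* The set O of formal symbols: None is the unit symbol and
   Some (a, i, j) is K_M^{i,j|a}. *)
Definition symb (k d : nat) : finType := option ('I_k * 'I_d * 'I_d).

Definition sym1 (k d : nat) : symb k d := None.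

Definition symK (k d : nat) (i j : 'I_d) (a : 'I_k) : symb k d :=
  Some (a, i, j).

Definition symdag (k d : nat) (s : symb k d) : symb k d :=
  if s is Some (a, i, j) then symK j i a else sym1 k d.

(* entry G m s n t is <m|<s| G |n>|t>, which plays the role of
   Tr[(|n><m| (x) t s^dagger) sigma]. *)
Definition entry (C : numClosedFieldType) (k d : nat)
    (G : 'M[C]_(d * #|symb k d|))
    (m : 'I_d) (s : symb k d) (n : 'I_d) (t : symb k d) : C :=
  G (mxtens_index (m, enum_rank s)) (mxtens_index (n, enum_rank t)).

Record SDP_feasible (C : numClosedFieldType) (d k : nat)
    (rho : 'M[C]_d) (M : 'I_k -> 'M[C]_d)
    (Gamma : 'I_k -> 'M[C]_(d * #|symb k d|)) : Prop := {
  SDP_psd : forall e, psdmx (Gamma e);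
  SDP_marginal : forall i j,
    \sum_e entry (Gamma e) i (sym1 k d) j (sym1 k d) = rho i j;
  SDP_povm : forall a i j,
    \sum_e \sum_l entry (Gamma e) l (sym1 k d) l (symK i j a) = M a i j;
  SDP_prob : forall a,
    \sum_e \sum_i \sum_j entry (Gamma e) j (sym1 k d) i (symK i j a)
    = \tr (M a *m rho);
  SDP_dag : forall s e m n,
    entry (Gamma e) m (sym1 k d) n s
    = entry (Gamma e) m (symdag s) n (sym1 k d);
  SDP_complete : forall e m n i j,
    \sum_a entry (Gamma e) m (sym1 k d) n (symK i j a)
    = (i == j)%:R * entry (Gamma e) m (sym1 k d) n (sym1 k d);
  SDP_proj : forall a b e m n i j,
    \sum_l entry (Gamma e) m (symdag (symK l j b)) n (symdag (symK l i a))
    = (a == b)%:R * entry (Gamma e) m (sym1 k d) n (symK i j a) }.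

Definition SDP_objective (C : numClosedFieldType) (d k : nat)
    (Gamma : 'I_k -> 'M[C]_(d * #|symb k d|)) : C :=
  \sum_a \sum_i \sum_j entry (Gamma a) j (sym1 k d) i (symK i j a).

(* \sum_(i, j) |i><j| (x) K^{i,j} *)
Definition op_of_blocks (C : numClosedFieldType) (d D : nat)
    (K : 'I_d -> 'I_d -> 'M[C]_D) : 'M[C]_(d * D) :=
  \sum_i \sum_j (delta_mx i j : 'M[C]_d) *t K i j.

(* Main.v *)
(* A Gram decomposition of the Gamma_e yields vectors u_{e,m,s}, to be read as
   s^dagger psi^e_m, with mutually orthogonal families for distinct e. The
   vectors v^a_{j,e,m} = sum_l |l> (x) (K^{l,j|a} psi^e_m), whose components are
   all among the u_{e,m,s}, are orthogonal for distinct a by the projection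
   constraint, and sum over a to |j> (x) psi^e_m, since the difference has norm
   zero by the completeness constraint. Hence the orthogonal projectors Pi^a
   onto the spans of the v^a, completed arbitrarily to a measurement, map
   |j> (x) psi^e_m to v^a_{j,e,m}; their blocks are the K^{i,j|a}, and the
   states are the pure ones sum_m |m> (x) psi^e_m. *)
Require Import Defs.
From HB Require Import structures.
From mathcomp Require Import all_boot all_order all_algebra.
From mathcomp Require Import spectral sesquilinear.
From mathcomp Require Import complex mxtens reals.

Import Order.TTheory GRing.Theory Num.Theory.
Local Open Scope ring_scope.
Local Open Scope sesquilinear_scope.

(** * Adjoints, positive semidefinite matrices and projective measurements *)

Section ComplexMatrices.
Context {C : numClosedFieldType}.

Lemma adjmxM m n p (A : 'M[C]_(m, n)) (B : 'M[C]_(n, p)) :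
  (A *m B)^t* = B^t* *m A^t*.
Proof. by rewrite trmx_mul map_mxM. Qed.

Lemma adjmxD m n (A B : 'M[C]_(m, n)) : (A + B)^t* = A^t* + B^t*.
Proof. by rewrite linearD /= map_mxD. Qed.

Lemma adjmxB m n (A B : 'M[C]_(m, n)) : (A - B)^t* = A^t* - B^t*.
Proof. by rewrite linearB /= map_mxB. Qed.

Lemma adjmx0 m n : (0 : 'M[C]_(m, n))^t* = 0.
Proof. by rewrite trmx0 map_mx0. Qed.

Lemma adjmx1 n : (1%:M : 'M[C]_n)^t* = 1%:M.
Proof. by rewrite trmx1 map_mx1. Qed.

Lemma adjmx_sum m n (I : finType) (F : I -> 'M[C]_(m, n)) :
  (\sum_i F i)^t* = \sum_i (F i)^t*.
Proof. by rewrite linear_sum map_mx_sum. Qed.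

Lemma gram_diag_ge0 m n (Y : 'M[C]_(m, n)) i : 0 <= (Y^t* *m Y) i i.
Proof.
by rewrite mxE sumr_ge0 // => j _; rewrite !mxE mulrC mul_conjC_ge0.
Qed.

(** Each diagonal entry of the Gram matrix is the squared norm of a column of [Y]. *)
Lemma gram_eq0 m n (Y : 'M[C]_(m, n)) : Y^t* *m Y = 0 -> Y = 0.
Proof.
move=> Y0; apply/matrixP=> i j; rewrite mxE; move/matrixP/(_ j j): Y0.
rewrite !mxE => /psumr_eq0P Yj0; apply/eqP; rewrite -mul_conjC_eq0 mulrC.
have := Yj0 _ i isT; rewrite !mxE => ->// l _.
by rewrite !mxE mulrC mul_conjC_ge0.
Qed.

Lemma psdmx_mul_adj m n (Y : 'M[C]_(m, n)) : psdmx (Y *m Y^t*).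
Proof.
split=> [|v]; first by rewrite adjmxM trmxCK.
rewrite mulmxA -mulmxA -[X in X *m (_ *m _)]trmxCK adjmxM trmxCK.
exact: gram_diag_ge0.
Qed.

(** By the spectral theorem [A = P^t* *m diag_mx s *m P] with [P] unitary; the square roots of the
    eigenvalues give [W]. *)
Lemma psdmx_factor n (A : 'M[C]_n) :
  psdmx A -> exists W : 'M[C]_n, A = W *m W^t*.
Proof.
case=> Aherm Apos.
have /orthomx_spectralP : A \is normalmx by apply/normalmxP; rewrite Aherm.
have := spectral_unitarymx A.
set P := spectralmx A; set s := spectral_diag A => Pu.
rewrite invmx_unitary // => AE.
have s_ge0 i : 0 <= s 0 i.
  (* The quadratic form at the i-th unit eigenvector is the i-th eigenvalue. *)
  have := Apos (P^t* *m delta_mx i 0).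
  rewrite {1}AE adjmxM trmxCK !mulmxA !mulmxtVK //.
  by rewrite trmx_delta map_delta_mx -rowE -colE !mxE eqxx mulr1n.
pose r := \row_i sqrtC (s 0 i).
exists (P^t* *m diag_mx r); rewrite {1}AE adjmxM trmxCK -!mulmxA.
congr (_ *m _); rewrite mulmxA; congr (_ *m _).
rewrite tr_diag_mx map_diag_mx mulmx_diag; congr diag_mx.
apply/rowP=> i; rewrite !mxE.
by rewrite -normCK ger0_norm ?sqrtC_ge0 // sqrtCK.
Qed.

(** [proj_ortho] acts on row vectors, so it is applied to [X^t*]; being hermitian, it also projects
    onto the column span of [X]. The factor [B] serves to show that [P] kills all vectors orthogonal
    to that span. *)
Lemma ortho_projector_exists m n (X : 'M[C]_(m, n)) :
  exists P : 'M[C]_m, [/\ P^t* = P, P *m P = P, P *m X = X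
    & exists B, P = B *m X^t*].
Proof.
pose P := proj_ortho (X^t*).
have PX : X^t* *m P = X^t* by rewrite proj_ortho_id.
have Psub : (P <= X^t*)%MS by rewrite proj_orthoE.
have P1 : P = P *m P^t*.
  suff PtE : P^t* = P *m P^t*.
    transitivity ((P *m P^t*)^t*); first by rewrite -PtE trmxCK.
    by rewrite adjmxM trmxCK.
  (* The rows of [1%:M - P] are orthogonal to the row space of [X^t*], which contains the rows of
     [P]. *)
  apply/eqP; rewrite -subr_eq0 -[X in X - _]mul1mx -mulmxBl; apply/eqP.
  apply/orthomx1P; rewrite -[P in X in (X <= _)%MS]mul1mx.
  apply: (submx_trans (proj_ortho_compl_sub (X^t*) _)).
  by rewrite submx_ortho // ortho_id.
have Pherm : P^t* = P by rewrite {1}P1 adjmxM trmxCK -P1.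
exists P; split=> //; first by rewrite -{2}Pherm -P1.
  by move/(congr1 (fun Y => Y^t*)): PX; rewrite adjmxM !trmxCK Pherm.
by case/submxP: Psub => B ->; exists B.
Qed.

(* The unused complement is added to the outcome a0. *)
Lemma projective_measurement_exists m n k (a0 : 'I_k)
    (X : 'I_k -> 'M[C]_(m, n)) :
  (forall a b, a != b -> (X a)^t* *m X b = 0) ->
  exists2 Pi : 'I_k -> 'M[C]_m, projective_measurement Pi
    & forall a b, Pi a *m X b = if a == b then X b else 0.
Proof.
move=> Xorth.
have /fin_all_exists [P PP] a := ortho_projector_exists m n (X a).
have Pherm a : (P a)^t* = P a by case: (PP a).
have PX a b : P a *m X b = if a == b then X b else 0.
  case: (PP a) => _ _ PX [B PB]; case: eqP => [<-//|/eqP ab].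
  by rewrite PB -mulmxA Xorth // mulmx0.
have PaPb a b : P a *m P b = if a == b then P a else 0.
  case: (PP a) => _ Pid _ _; case: eqP => [<-//|/eqP ab].
  case: (PP b) => _ _ _ [B PB]; rewrite -[P b]Pherm PB adjmxM trmxCK mulmxA.
  by rewrite PX (negPf ab) mul0mx.
pose Q := 1%:M - \sum_a P a.
have PQ a : P a *m Q = 0.
  rewrite mulmxBr mulmx1 mulmx_sumr (bigD1 a) //= big1 => [|b ba].
    by rewrite PaPb eqxx addr0 subrr.
  by rewrite PaPb eq_sym (negPf ba).
have Qherm : Q^t* = Q.
  by rewrite adjmxB adjmx1 adjmx_sum; congr (_ - _); apply: eq_bigr.
have QP a : Q *m P a = 0 by rewrite -Qherm -Pherm -adjmxM PQ adjmx0.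
have QQ : Q *m Q = Q.
  by rewrite {1}/Q mulmxBl mul1mx mulmx_suml big1 ?subr0 // => a _; rewrite PQ.
exists (fun a => P a + (if a == a0 then Q else 0)) => [|a b].
  split=> [a|a b|].
  - by rewrite adjmxD Pherm; case: eqP; rewrite ?adjmx0 ?Qherm.
  - rewrite mulmxDl !mulmxDr PaPb.
    have -> : P a *m (if b == a0 then Q else 0) = 0.
      by case: eqP; rewrite ?PQ ?mulmx0.
    have -> : (if a == a0 then Q else 0) *m P b = 0.
      by case: eqP; rewrite ?QP ?mul0mx.
    rewrite addr0 add0r; case: (eqVneq a b) => [<-|ab].
      by case: eqP; rewrite ?QQ ?mulmx0.
    case: (eqVneq a a0) ab => [->|_ _]; last by rewrite mul0mx addr0.
    by rewrite eq_sym => /negPf ->; rewrite mulmx0 addr0.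
  - by rewrite big_split /= -big_mkcond big_pred1_eq /Q addrC subrK.
(* The complement [Q] does not disturb [X b]: among the subtracted projectors [P b] fixes it and the
   others kill it. *)
rewrite mulmxDl PX; have -> : (if a == a0 then Q else 0) *m X b = 0.
  case: eqP; rewrite ?mul0mx // => _.
  rewrite mulmxBl mul1mx mulmx_suml (bigD1 b) //= PX eqxx big1 ?addr0 ?subrr //.
  by move=> c cb; rewrite PX (negPf cb).
by rewrite addr0.
Qed.

(** The vectors [v a t] become the columns of one matrix [X a], indexed through the enumeration of
    [T]. *)
Lemma projective_measurement_cols m k (a0 : 'I_k) (T : finType)
    (v : 'I_k -> T -> 'cV[C]_m) :
  (forall a b s t, a != b -> (v a s)^t* *m v b t = 0) ->
  exists2 Pi : 'I_k -> 'M[C]_m, projective_measurement Pi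
    & forall a b t, Pi a *m v b t = if a == b then v b t else 0.
Proof.
move=> vorth.
pose X a := \matrix_(x < m, y < #|T|) v a (enum_val y) x 0.
have colX a t : col (enum_rank t) (X a) = v a t.
  by apply/colP=> x; rewrite !mxE enum_rankK.
have [a b ab|Pi Pimeas PiX] := projective_measurement_exists _ _ _ a0 X.
  apply/matrixP=> y z.
  move/matrixP/(_ 0 0): (vorth a b (enum_val y) (enum_val z) ab).
  by rewrite !mxE => E; rewrite -[RHS]E; apply: eq_bigr => x _; rewrite !mxE.
exists Pi => // a b t; rewrite -colX colE mulmxA PiX.
by case: eqP; rewrite ?mul0mx.
Qed.

(** * Product indices, block operators and Gram families *)

Lemma sum_mxtens_index (V : nmodType) d D (F : 'I_(d * D) -> V) :
  \sum_x F x = \sum_(i < d) \sum_(p < D) F (mxtens_index (i, p)).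
Proof.
rewrite pair_bigA /= (reindex (@mxtens_index d D)) /=; last first.
  exists (@mxtens_unindex d D) => x _; first exact: mxtens_indexK.
  exact: mxtens_unindexK.
by apply: eq_bigr => -[].
Qed.

Lemma op_of_blocksE d D (K : 'I_d -> 'I_d -> 'M[C]_D) i p j q :
  op_of_blocks K (mxtens_index (i, p)) (mxtens_index (j, q)) = K i j p q.
Proof.
rewrite /op_of_blocks summxE (bigD1 i) //= [X in _ + X]big1
  => [|i' ii']; last first.
  rewrite summxE big1 // => j' _.
  by rewrite tensmxE mxE eq_sym (negPf ii') mul0r.
rewrite addr0 summxE (bigD1 j) //= [X in _ + X]big1 => [|j' jj']; last first.
  by rewrite tensmxE mxE [j == _]eq_sym (negPf jj') andbF mul0r.
by rewrite addr0 tensmxE mxE !eqxx mul1r.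
Qed.

(** This allows the measurement to be built as a whole, the operators K^{i,j|a} being read off
    afterwards as its blocks. *)
Lemma op_of_blocks_surj d D (A : 'M[C]_(d * D)) :
  op_of_blocks (fun i j => \matrix_(p, q)
    A (mxtens_index (i, p)) (mxtens_index (j, q))) = A.
Proof.
apply/matrixP=> x y; case: (mxtens_indexP x) => i p.
by case: (mxtens_indexP y) => j q; rewrite op_of_blocksE mxE.
Qed.

(** The rows of a factor of [G e] are placed in the e-th of [k] orthogonal copies of C^N, so that
    inner products between different [e] vanish. This is needed because the SDP constrains each
    Gamma_e separately, whereas one measurement must serve all [e]. *)
Lemma psdmx_family_gram k N (G : 'I_k -> 'M[C]_N) :
  (forall e, psdmx (G e)) ->
  exists (D : nat) (w : 'I_k -> 'I_N -> 'I_D -> C), forall e f x y,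
    \sum_p w e x p * (w f y p)^* = (e == f)%:R * G e x y.
Proof.
move=> Gpsd; have /fin_all_exists [W WE] e := psdmx_factor N _ (Gpsd e).
exists (k * N)%N, (fun e x p => (e == (mxtens_unindex p).1)%:R
                                 * W e x (mxtens_unindex p).2) => e f x y.
rewrite sum_mxtens_index.
under eq_bigr => g _ do under eq_bigr => p _ do rewrite mxtens_indexK.
rewrite (bigD1 e) //= [X in _ + X]big1 => [|g ge]; last first.
  by rewrite big1 // => p _; rewrite eq_sym (negPf ge) !mul0r.
rewrite addr0 WE mxE mulr_sumr; apply: eq_bigr => p _.
rewrite !mxE eqxx mul1r [f == e]eq_sym.
by case: (eqVneq e f) => [<-|_]; rewrite ?mul1r // !mul0r conjC0 mulr0.
Qed.

End ComplexMatrices.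

(** * Gram relations of the vectors realizing the SDP solution *)

Section Realization.
Context {C : numClosedFieldType} {d k : nat} {rho : 'M[C]_d}
  {M : 'I_k -> 'M[C]_d} {Gamma : 'I_k -> 'M[C]_(d * #|symb k d|)}
  (Gamma_feas : SDP_feasible rho M Gamma)
  {D : nat} {u : 'I_k -> 'I_d -> symb k d -> 'I_D -> C}
  (gram_u : forall e f m n s t, \sum_p u e m s p * (u f n t p)^*
     = (e == f)%:R * entry (Gamma e) m s n t).

Let one := sym1 k d.

(* |j> (x) psi^e_m, where psi^e_m = u e m one. *)
Definition basis_col (j : 'I_d) (e : 'I_k) (m : 'I_d) : 'cV[C]_(d * D) :=
  \col_x (((mxtens_unindex x).1 == j)%:R * u e m one (mxtens_unindex x).2).

(* The value that Pi^a must take at basis_col j e m. *)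
Definition image_col (a : 'I_k) (j : 'I_d) (e : 'I_k) (m : 'I_d) :
    'cV[C]_(d * D) :=
  \col_x u e m (symdag (symK (mxtens_unindex x).1 j a)) (mxtens_unindex x).2.

(** The sum over the first tensor factor is the left side of the projection constraint. *)
Lemma image_col_gram a b i j e f m n :
  ((image_col a i f n)^t* *m image_col b j e m) 0 0
  = (a == b)%:R * ((e == f)%:R * entry (Gamma e) m one n (symK i j a)).
Proof.
rewrite mxE sum_mxtens_index mulrCA -(SDP_proj Gamma_feas) mulr_sumr.
apply: eq_bigr => l _; rewrite -gram_u; apply: eq_bigr => p _.
by rewrite !mxE mxtens_indexK mulrC.
Qed.

Lemma basis_col_adj_mul (y : 'cV[C]_(d * D)) i f n :
  ((basis_col i f n)^t* *m y) 0 0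
  = \sum_p y (mxtens_index (i, p)) 0 * (u f n one p)^*.
Proof.
rewrite mxE sum_mxtens_index (bigD1 i) //= [X in _ + X]big1 ?addr0 => [|l li].
  apply: eq_bigr => p _.
  by rewrite !mxE mxtens_indexK eqxx mul1r mulrC.
rewrite big1 // => p _.
by rewrite !mxE mxtens_indexK (negPf li) mul0r conjC0 mul0r.
Qed.

(** The dagger constraint moves the symbol to the right index, which gives the same value as
    [image_col_gram] for equal outcomes. *)
Lemma basis_image_gram b i j e f m n :
  ((basis_col i f n)^t* *m image_col b j e m) 0 0
  = (e == f)%:R * entry (Gamma e) m one n (symK i j b).
Proof.
rewrite basis_col_adj_mul (SDP_dag Gamma_feas) -gram_u.
by apply: eq_bigr => p _; rewrite mxE mxtens_indexK.
Qed.

Lemma basis_col_gram i j e f m n :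
  ((basis_col i f n)^t* *m basis_col j e m) 0 0
  = (e == f)%:R * ((i == j)%:R * entry (Gamma e) m one n one).
Proof.
rewrite basis_col_adj_mul mulrCA -gram_u mulr_sumr.
by apply: eq_bigr => p _; rewrite mxE mxtens_indexK mulrA.
Qed.

(** With y the basis vector and x_a its images, <y,x_a> = <x_a,x_a>, the x_a are pairwise
    orthogonal, and completeness gives <y,y> as the sum of the <y,x_a>; hence y minus the sum of the
    x_a has norm zero. *)
Lemma sum_image_col j e m : \sum_a image_col a j e m = basis_col j e m.
Proof.
set y := RHS; set x := fun a => image_col a j e m.
have yx a : y^t* *m x a = (x a)^t* *m x a.
  apply/matrixP=> r s; rewrite !ord1 basis_image_gram image_col_gram.
  by rewrite !eqxx !mul1r.
have xy a : (x a)^t* *m y = (x a)^t* *m x a.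
  by rewrite -[y]trmxCK -adjmxM yx adjmxM trmxCK.
have xx a b : a != b -> (x a)^t* *m x b = 0.
  move=> ab; apply/matrixP=> r s.
  by rewrite !ord1 image_col_gram (negPf ab) mul0r mxE.
have yy : y^t* *m y = \sum_a y^t* *m x a.
  apply/matrixP=> r s; rewrite !ord1 basis_col_gram summxE.
  rewrite -(SDP_complete Gamma_feas) mulr_sumr.
  by apply: eq_bigr => a _; rewrite basis_image_gram.
apply/eqP; rewrite eq_sym -subr_eq0; apply/eqP/gram_eq0.
rewrite adjmxB adjmx_sum mulmxBl !mulmxBr mulmx_sumr yy subrr sub0r.
rewrite !mulmx_suml; apply/eqP; rewrite oppr_eq0 subr_eq0; apply/eqP.
apply: eq_bigr => a _; rewrite xy mulmx_sumr (bigD1 a) //= big1 ?addr0 //.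
by move=> b ba; rewrite xx // eq_sym.
Qed.

(** * The pure states and their marginal on the system *)

Definition state_col (e : 'I_k) : 'cV[C]_(d * D) :=
  \col_x u e (mxtens_unindex x).1 one (mxtens_unindex x).2.

Lemma state_col_sum e : state_col e = \sum_m basis_col m e m.
Proof.
apply/colP=> x; rewrite mxE summxE (bigD1 (mxtens_unindex x).1) //=.
rewrite big1 ?addr0 => [|m mx]; first by rewrite mxE eqxx mul1r.
by rewrite mxE eq_sym (negPf mx) mul0r.
Qed.

Definition state_op (e : 'I_k) : 'M[C]_(d * D) :=
  state_col e *m (state_col e)^t*.

Lemma state_opE e m p n q :
  state_op e (mxtens_index (m, p)) (mxtens_index (n, q))
  = u e m one p * (u e n one q)^*.
Proof. by rewrite mxE big_ord1 !mxE !mxtens_indexK. Qed.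

Lemma ptraceM_state_op e m n :
  ptraceM (state_op e) m n = entry (Gamma e) m one n one.
Proof.
rewrite mxE; under eq_bigr => p _ do rewrite state_opE.
by rewrite gram_u eqxx mul1r.
Qed.

Lemma ptraceM_sum (I : finType) (F : I -> 'M[C]_(d * D)) :
  ptraceM (\sum_i F i) = \sum_i ptraceM (F i).
Proof.
apply/matrixP=> m n; rewrite mxE summxE.
under [RHS]eq_bigr => i _ do rewrite mxE.
by rewrite exchange_big; apply: eq_bigr => p _; rewrite summxE.
Qed.

Lemma mxtrace_ptraceM (A : 'M[C]_(d * D)) : \tr (ptraceM A) = \tr A.
Proof.
rewrite /mxtrace sum_mxtens_index; apply: eq_bigr => i _.
by rewrite mxE.
Qed.

Lemma ptraceM_sum_state_op : ptraceM (\sum_e state_op e) = rho.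
Proof.
apply/matrixP=> i j; rewrite ptraceM_sum summxE -(SDP_marginal Gamma_feas).
by apply: eq_bigr => e _; rewrite ptraceM_state_op.
Qed.

Lemma psdmx_state_op e : psdmx (state_op e).
Proof. exact: psdmx_mul_adj. Qed.

(** The traces of the [state_op f] are nonnegative and add up to the trace of [rho]. *)
Lemma state_op_subnormalized e :
  \tr rho = 1 -> subnormalized_state (state_op e).
Proof.
move=> rho1; split; first exact: psdmx_state_op.
have tr_ge0 f : 0 <= \tr (state_op f).
  by rewrite mxtrace_mulC /mxtrace sumr_ge0 // => i _; apply: gram_diag_ge0.
rewrite -rho1 -ptraceM_sum_state_op mxtrace_ptraceM raddf_sum (bigD1 e) //=.
by rewrite lerDl sumr_ge0.
Qed.

(** * Action of the measurement on the realizing vectors and states *)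

Context {Pi : 'I_k -> 'M[C]_(d * D)}
  (Pi_image : forall a b j e m,
     Pi a *m image_col b j e m = if a == b then image_col b j e m else 0).

(** In the decomposition of the basis vector into its images, [Pi a] keeps only the a-th term. *)
Lemma Pi_basis_col a j e m : Pi a *m basis_col j e m = image_col a j e m.
Proof.
rewrite -sum_image_col mulmx_sumr (bigD1 a) //= big1 => [|b ba].
  by rewrite Pi_image eqxx addr0.
by rewrite Pi_image eq_sym (negPf ba).
Qed.

(** The trace is <psi|Pi^a|psi>, expanded along psi = sum_m |m> (x) psi^e_m. It yields both the
    objective and the probability constraint. *)
Lemma trace_Pi_state_op a e :
  \tr (Pi a *m state_op e)
  = \sum_i \sum_j entry (Gamma e) j one i (symK i j a).
Proof.
rewrite mulmxA mxtrace_mulC /mxtrace big_ord1 state_col_sum adjmx_sum.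
rewrite !mulmx_sumr summxE exchange_big /=; apply: eq_bigr => j _.
rewrite Pi_basis_col mulmx_suml summxE; apply: eq_bigr => i _.
by rewrite basis_image_gram eqxx mul1r.
Qed.

(** Since Tr_S of the total state is the sum over e and l of |psi^e_l><psi^e_l|, entry (i, j) is the
    sum of the <psi^e_l|K^{i,j|a}|psi^e_l>. *)
Lemma ptraceM_Pi_marginal a :
  ptraceM (Pi a *m ((1%:M : 'M[C]_d) *t ptraceS (\sum_e state_op e))) = M a.
Proof.
apply/matrixP=> i j; rewrite -(SDP_povm Gamma_feas) mxE.
transitivity (\sum_e \sum_l
    ((basis_col i e l)^t* *m (Pi a *m basis_col j e l)) 0 0); last first.
  apply: eq_bigr => e _; apply: eq_bigr => l _.
  by rewrite Pi_basis_col basis_image_gram eqxx mul1r.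
(* The sums on the right are reordered with [p] and the product index [x] outermost, as on the left;
   the summands then agree. *)
under [RHS]eq_bigr => e _ do under eq_bigr => l _ do rewrite basis_col_adj_mul.
rewrite [RHS](eq_bigr _ (fun e _ => exchange_big _ _ _ _ _ _)) /=.
rewrite exchange_big /=; apply: eq_bigr => p _.
rewrite mxE; under [RHS]eq_bigr => e _ do
  under eq_bigr => l _ do rewrite mxE mulr_suml.
rewrite [RHS](eq_bigr _ (fun e _ => exchange_big _ _ _ _ _ _)) /=.
rewrite exchange_big /=; apply: eq_bigr => x _.
case: (mxtens_indexP x) => l q.
rewrite tensmxE !mxE !mulr_sumr [RHS]exchange_big; apply: eq_bigr => m _ /=.
rewrite summxE !mulr_sumr; apply: eq_bigr => e _.
by rewrite state_opE mxE mxtens_indexK !mulrA.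
Qed.

End Realization.

(** * Assembling the feasible point of (P) *)

Theorem theorem1 (R : realType) (d k : nat) (hd : (0 < d)%N) (hk : (0 < k)%N)
    (rho : 'M[R[i]]_d) (M : 'I_k -> 'M[R[i]]_d)
    (Gamma : 'I_k -> 'M[R[i]]_(d * #|symb k d|)) (c : R[i]) :
  density_operator rho ->
  povm M ->
  SDP_feasible rho M Gamma ->
  SDP_objective Gamma = c ->
  exists (D : nat) (K : 'I_d -> 'I_d -> 'I_k -> 'M[R[i]]_D)
         (sigma : 'I_k -> 'M[R[i]]_(d * D)),
    let Pi := fun a : 'I_k => op_of_blocks (fun i j => K i j a) in
    P_feasible rho M sigma Pi /\ P_objective sigma Pi = c.
Proof.
move=> [_ rho1] _ Gamma_feas <-.
have [D [w gram_w]] := psdmx_family_gram _ _ _ (SDP_psd Gamma_feas).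
pose u e m s := w e (mxtens_index (m, enum_rank s)).
have gram_u e f m n s t : \sum_p u e m s p * (u f n t p)^*
    = (e == f)%:R * entry (Gamma e) m s n t by exact: gram_w.
(* All triples (j, e, m) enter one family, so the projectors do not depend on [e]. Outcome 0,
   written [Ordinal hk], receives the complement. *)
pose v a (t : 'I_d * 'I_k * 'I_d) := image_col (u := u) a t.1.1 t.1.2 t.2.
have [a b s t ab|Pi Pi_meas Pi_v] :=
    projective_measurement_cols _ _ (Ordinal hk) _ v.
  apply/matrixP=> x y; rewrite !ord1 (image_col_gram Gamma_feas gram_u).
  by rewrite (negPf ab) mul0r mxE.
have Pi_image a b j e m : Pi a *m image_col (u := u) b j e m
    = if a == b then image_col (u := u) b j e m else 0.
  exact: (Pi_v a b (j, e, m)).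
exists D, (fun i j a => \matrix_(p, q)
  Pi a (mxtens_index (i, p)) (mxtens_index (j, q))), (state_op (u := u)) => Pi'.
have Pi'E a : Pi' a = Pi a by exact: op_of_blocks_surj.
have tr_Pi := trace_Pi_state_op Gamma_feas gram_u Pi_image.
split; last first.
  by apply: eq_bigr => a _; rewrite Pi'E tr_Pi.
split=> [|e||a|a].
- case: Pi_meas => Pi_adj Pi_orth Pi_sum; split=> [a|a b|].
  + by rewrite Pi'E.
  + by rewrite !Pi'E.
  + by rewrite -Pi_sum; apply: eq_bigr.
- exact: (state_op_subnormalized Gamma_feas gram_u).
- exact: (ptraceM_sum_state_op Gamma_feas gram_u).
- by rewrite Pi'E (ptraceM_Pi_marginal Gamma_feas gram_u Pi_image).
- rewrite Pi'E mulmx_sumr raddf_sum -(SDP_prob Gamma_feas).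
  by apply: eq_bigr => e _; rewrite /= tr_Pi.
Qed.
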